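(* Let $J,R,Q\in\mathbb{C}^{n\times n}$ with $J=-J^H$, $R=R^H\ge 0$, $Q=Q^H>0$, let $B\in\mathbb{C}^{n\times m}$, $C\in\mathbb{C}^{p\times n}$, and consider the linear system $$\dot x=(J-R)Qx+(J-R)Bu,\qquad y=Cx,$$ with transfer function $G(s):=C(sI_n-(J-R)Q)^{-1}(J-R)B$. Let $\widehat s\in\mathbb{C}$ be a given point, $\widehat c\in\mathbb{C}^p$ a given direction and $N\geq 1$ an integer, with $\widehat sI_n-(J-R)Q$ invertible. Suppose that $W_k$ is a matrix with orthonormal columns such that $$\left(\widehat c^{\,H}C(\widehat sI_n-(J-R)Q)^{-1}(\widehat sI_n-(J-R)Q)^{-(\ell-1)}\right)^H\in\operatorname{Im}(W_k)\qquad\text{for }\ell=1,\dots,N,$$ and such that $W_k^H(J-R)^HW_k$ is invertible. Let $$V_k:=(J-R)^HW_k\,(W_k^H(J-R)^HW_k)^{-1},$$ $$J_k:=W_k^HJW_k,\quad Q_k:=V_k^HQV_k,\quad R_k:=W_k^HRW_k,\quad B_k:=V_k^HB,\quad C_k:=CV_k.$$ Then the reduced order system $$\dot x_k=(J_k-R_k)Q_kx_k+(J_k-R_k)B_ku,\qquad y_k=C_kx_k$$ is such that $\dot x_k=(J_k-R_k)Q_kx_k$ is dissipative Hamiltonian. Furthermore, provided that $\widehat sI-(J_k-R_k)Q_k$ is invertible, the transfer function $$G_k(s):=C_k(sI-(J_k-R_k)Q_k)^{-1}(J_k-R_k)B_k$$ of the reduced order system satisfies $$\widehat c^{\,H}G^{(\ell)}(\widehat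 s)=\widehat c^{\,H}G_k^{(\ell)}(\widehat s)\qquad\text{for }\ell=0,\dots,N-1.$$
   Context: $A^H$ is the conjugate transpose of $A$, and $\operatorname{Im}(A)$ is the column space of $A$. For Hermitian matrices, $>0$ means positive definite and $\ge 0$ means positive semi-definite. A system $\dot x=(J-R)Qx$ is called dissipative Hamiltonian (DH) if $J$ is skew-Hermitian, $R$ is Hermitian positive semi-definite and $Q$ is Hermitian positive definite. $G^{(\ell)}(s)$ denotes the $\ell$-th derivative of $G$ at $s$ (with $G^{(0)}=G$), and $I$ denotes an identity matrix of appropriate size. *)

(* Defs.v *)
From mathcomp Require Export all_boot all_order all_algebra.
From mathcomp Require Export all_classical all_reals all_analysis.
From mathcomp Require Export complex.

Set Implicit Arguments.
Unset Strict Implicit.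
Unset Printing Implicit Defensive.

Export Order.TTheory GRing.Theory Num.Theory.
(* Gives T[i], like every numFieldType, its topology and its normed-module
   structure over itself, so that derivatives below are complex derivatives. *)
Export numFieldNormedType.Exports.

(* Conjugate transpose. *)
Notation "A ^H" := (map_mx Num.conj (trmx A))
  (at level 1, format "A ^H") : ring_scope.

Local Open Scope classical_set_scope.
Local Open Scope ring_scope.

Section Definitions.
Variable T : realType.

Definition colspace m n (A : 'M[T[i]]_(m, n)) : set 'cV[T[i]]_m :=
  range (fun x : 'cV[T[i]]_n => A *m x).

Definition orthonormal_cols m n (W : 'M[T[i]]_(m, n)) : Prop :=
  W^H *m W = 1%:M.

(* The order on T[i] is partial: 0 <= z means that z is real and
   nonnegative, and likewise for 0 < z. *)
Definition herm_psd n (A : 'M[T[i]]_n) : Prop :=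
  A = A^H /\ forall x : 'cV[T[i]]_n, 0 <= (x^H *m A *m x) 0 0.

Definition herm_pd n (A : 'M[T[i]]_n) : Prop :=
  A = A^H /\ forall x : 'cV[T[i]]_n, x != 0 -> 0 < (x^H *m A *m x) 0 0.

Definition dissipative_Hamiltonian n (J R Q : 'M[T[i]]_n) : Prop :=
  [/\ J = - J^H, herm_psd R & herm_pd Q].

(* Transfer function of x' = A x + B u, y = C x. Where s is an eigenvalue of A,
   invmx, and hence the transfer function, has a meaningless default value. *)
Definition transfer_function n m p (A : 'M[T[i]]_n) (B : 'M[T[i]]_(n, m))
    (C : 'M[T[i]]_(p, n)) : T[i] -> 'M[T[i]]_(p, m) :=
  fun s => C *m invmx (s%:M - A) *m B.

End Definitions.

(* Main.v *)
Require Import Defs.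

(* Put F = J - R.  The choice of V gives W^H V = 1 and
   (J_k - R_k) V^H = W^H F, so the reduced system is the Petrov-Galerkin
   projection of the full one: its matrices are W^H (F Q) V, W^H (F B), C V.
   If the rows c^H C M^-(l+1) = z_l W^H lie in the row space of W^H, multiplying
   on the right by M V gives z_l (W^H M V) = z_(l-1), with z_(-1) = c^H C V,
   whence z_l = c^H C_k M_k^-(l+1).  The l-th derivative of a
   transfer function at s being (-1)^l l! times C M^-(l+1) B, this is the
   interpolation property. *)

Set Implicit Arguments.
Unset Strict Implicit.

Local Open Scope ring_scope.

(** * Continuity of matrix operations along a filter *)

Section MatrixLimits.
Local Open Scope classical_set_scope.
Context {K : numFieldType} {U : Type} {F : set_system U} {FF : Filter F}.

(** A neighbourhood of [M] contains a box of entrywise neighbourhoods, and a filter is closed under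
    the finite intersection over [i] and [j]. *)
Lemma cvg_mx m n (f : U -> 'M[K]_(m, n)) (M : 'M[K]_(m, n)) :
  (forall i j, f x i j @[x --> F] --> M i j) -> f x @[x --> F] --> M.
Proof.
move=> fM A [P PM PA]; apply: filterS => [x|]; first exact: PA.
by apply: filter_forall => i; apply: filter_forall => j; exact: fM (PM i j).
Qed.

Lemma cvg_coord m n (f : U -> 'M[K]_(m, n)) (M : 'M[K]_(m, n)) i j :
  f x @[x --> F] --> M -> f x i j @[x --> F] --> M i j.
Proof. by move=> fM; exact: cvg_comp fM (@coord_continuous K m n i j M). Qed.

Lemma cvg_sumr I (r : seq I) (f : I -> U -> K) (l : I -> K) :
  (forall i, f i x @[x --> F] --> l i) ->
  \sum_(i <- r) f i x @[x --> F] --> \sum_(i <- r) l i.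
Proof.
move=> fl; elim: r => [|i r IHr].
  by rewrite big_nil; under eq_fun do rewrite big_nil; exact: cvg_cst.
by rewrite big_cons; under eq_fun do rewrite big_cons; exact: cvgD.
Qed.

Lemma cvg_prodr I (r : seq I) (f : I -> U -> K) (l : I -> K) :
  (forall i, f i x @[x --> F] --> l i) ->
  \prod_(i <- r) f i x @[x --> F] --> \prod_(i <- r) l i.
Proof.
move=> fl; elim: r => [|i r IHr].
  by rewrite big_nil; under eq_fun do rewrite big_nil; exact: cvg_cst.
by rewrite big_cons; under eq_fun do rewrite big_cons; exact: cvgM.
Qed.

Lemma cvg_mulmx m n p (f : U -> 'M[K]_(m, n)) (g : U -> 'M[K]_(n, p))
    (A : 'M[K]_(m, n)) (B : 'M[K]_(n, p)) :
  f x @[x --> F] --> A -> g x @[x --> F] --> B ->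
  f x *m g x @[x --> F] --> A *m B.
Proof.
move=> fA gB; apply: cvg_mx => i j; under eq_fun do rewrite mxE.
by rewrite mxE; apply: cvg_sumr => k; apply: cvgM; exact: cvg_coord.
Qed.

Lemma cvg_det n (f : U -> 'M[K]_n) (A : 'M[K]_n) :
  f x @[x --> F] --> A -> \det (f x) @[x --> F] --> \det A.
Proof.
move=> fA; apply: cvg_sumr => s; apply: cvgM; first exact: cvg_cst.
by apply: cvg_prodr => i; exact: cvg_coord.
Qed.

Lemma cvg_adj n (f : U -> 'M[K]_n) (A : 'M[K]_n) :
  f x @[x --> F] --> A -> \adj (f x) @[x --> F] --> \adj A.
Proof.
move=> fA; apply: cvg_mx => i j; under eq_fun do rewrite mxE.
rewrite mxE; apply: cvgM; first exact: cvg_cst.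
apply: cvg_det; apply: cvg_mx => k l; under eq_fun do rewrite !mxE.
by rewrite !mxE; exact: cvg_coord.
Qed.

Lemma near_unitmx n (f : U -> 'M[K]_n) (A : 'M[K]_n) : f x @[x --> F] --> A ->
  A \in unitmx -> \forall x \near F, f x \in unitmx.
Proof.
move=> /cvg_det fA; rewrite unitmxE unitfE => A0.
near=> x; rewrite unitmxE unitfE; near: x.
exact: (@cvgr_neq0 _ K^o _ _ _ _ _ fA A0).
Unshelve. all: by end_near. Qed.

(** By Cramer's rule the inverse is [(\det A)^-1 *: \adj A], a continuous expression. [invmx]
    returns its argument off the units, so the formula is used only eventually along [F]. *)
Lemma cvg_invmx n (f : U -> 'M[K]_n) (A : 'M[K]_n) : f x @[x --> F] --> A ->
  A \in unitmx -> invmx (f x) @[x --> F] --> invmx A.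
Proof.
move=> fA Au.
have -> : invmx A = (\det A)^-1 *: \adj A by rewrite /invmx Au.
apply: (@cvg_trans _ ((\det (f x))^-1 *: \adj (f x) @[x --> F])).
  apply: near_eq_cvg; near=> x.
  by rewrite /invmx ifT//; near: x; exact: near_unitmx fA Au.
apply: cvgZ; last exact: cvg_adj.
by apply: cvgV; [rewrite -unitfE -unitmxE | exact: cvg_det].
Unshelve. all: by end_near. Qed.

End MatrixLimits.

(** * Derivatives of the resolvent *)

Section Resolvent.
Local Open Scope classical_set_scope.
Variables (K : numFieldType) (n : nat) (A : 'M[K]_n).
Local Notation res x := (invmx (x%:M - A)).

Lemma cvg_pencil U (F : set_system U) {FF : Filter F} (f : U -> K) (x : K) :
  f u @[u --> F] --> x -> (f u)%:M - A @[u --> F] --> x%:M - A.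
Proof.
move=> fx; apply: cvgB; last exact: cvg_cst.
apply: cvg_mx => i j; under eq_fun do rewrite mxE.
by rewrite mxE; exact: (@cvgMn _ K^o).
Qed.

Lemma near_pencil_unit (x : K) : x%:M - A \in unitmx ->
  \forall y \near x, (y : K)%:M - A \in unitmx.
Proof.
exact: near_unitmx (@cvg_pencil _ (nbhs x) _ id x (@cvg_id _ (nbhs x))).
Qed.

Lemma resolvent_identity (x y : K) :
  x%:M - A \in unitmx -> y%:M - A \in unitmx ->
  res y - res x = (x - y) *: (res y *m res x).
Proof.
move=> xu yu.
(* Both terms are written between [res y] on the left and [res x] on the right; the middle is then
   [(x%:M - A) - (y%:M - A)]. *)
rewrite -[res y in LHS]mulmx1 -{1}(mulmxV xu) -[res x in X in _ - X]mul1mx.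
rewrite -{1}(mulVmx yu) mulmxA -mulmxBl -mulmxBr.
rewrite opprB addrA subrK -raddfB /= mul_mx_scalar.
by rewrite -scalemxAl.
Qed.

(** The product rule by induction on [k]: the resolvent identity makes [- res x ^+ 2] the derivative
    of one factor. *)
Lemma cvg_resolvent_exp_quotient (x : K) k : x%:M - A \in unitmx ->
  h^-1 *: (res (h + x) ^+ k - res x ^+ k) @[h --> 0^']
    --> - (k%:R *: res x ^+ k.+1).
Proof.
move=> xu.
have Mx : (h + x)%:M - A @[h --> 0^'] --> x%:M - A.
  apply: cvg_pencil; suff : h + x @[h --> 0^'] --> 0 + x by rewrite add0r.
  by apply: cvgD; [exact: nbhs_dnbhs | exact: cvg_cst].
have Rx : res (h + x) @[h --> 0^'] --> res x by exact: cvg_invmx Mx xu.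
elim: k => [|k IHk].
  rewrite scale0r oppr0; under eq_fun do rewrite !expr0 subrr scaler0.
  exact: cvg_cst.
(* R_y^(k+1) - R_x^(k+1) = R_y (R_y^k - R_x^k) + (R_y - R_x) R_x^k *)
apply: (@cvg_trans _ (res (h + x) *m (h^-1 *: (res (h + x) ^+ k - res x ^+ k))
    + - (res (h + x) *m res x) *m res x ^+ k @[h --> 0^'])).
  apply: near_eq_cvg; near=> h.
  have h0 : h != 0 by near: h; exact: nbhs_dnbhs_neq.
  have hu : (h + x)%:M - A \in unitmx by near: h; exact: near_unitmx Mx xu.
  have -> : - (res (h + x) *m res x) = h^-1 *: (res (h + x) - res x).
    rewrite resolvent_identity// opprD addrCA subrr addr0 scalerA.
    by rewrite mulrN mulVf// scaleN1r.
  rewrite !exprS -!mulmxE -scalemxAr -scalemxAl -scalerDr mulmxBr mulmxBl.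
  by rewrite subrKA.
have -> : - (k.+1%:R *: res x ^+ k.+2) =
    res x *m - (k%:R *: res x ^+ k.+1) + - (res x *m res x) *m res x ^+ k.
  rewrite mulmxN -scalemxAr mulNmx -mulmxA !mulmxE -!exprS -opprD.
  by rewrite -natr1 scalerDl scale1r.
apply: cvgD; first exact: cvg_mulmx Rx IHk.
apply: cvg_mulmx; last exact: cvg_cst.
by apply: cvgN; apply: (cvg_mulmx Rx); exact: cvg_cst.
Unshelve. all: by end_near. Qed.

Lemma derive1n_resolvent m p (B : 'M[K]_(n, m)) (C : 'M[K]_(p, n)) l (x : K) :
  x%:M - A \in unitmx ->
  derive1n l (fun y => C *m res y *m B) x =
    ((-1) ^+ l * l`!%:R) *: (C *m res x ^+ l.+1 *m B).
Proof.
elim: l x => [|l IHl] x xu; first by rewrite mul1r scale1r expr1.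
rewrite derive1nS derive1E.
(* The induction hypothesis holds only where the pencil is invertible; this is a neighbourhood of
   [x], which is enough for a derivative at [x]. *)
rewrite (@near_eq_derive _ _ _ _
  (fun y => ((-1) ^+ l * l`!%:R) *: (C *m res y ^+ l.+1 *m B))); last first.
  by near=> y; apply: IHl; near: y; exact: near_pencil_unit.
rewrite -derive1E; apply: cvg_lim => //=.
(* The factor [h^-1] is moved between [C] and [B], onto the difference of resolvent powers. *)
under eq_fun => h.
  rewrite -scalerBr -mulmxBl -mulmxBr scalerA mulrC -scalerA.
  rewrite [h^-1 *: _]scalemxAl [h^-1 *: _]scalemxAr; over.
have -> : ((-1) ^+ l.+1 * (l.+1)`!%:R) *: (C *m res x ^+ l.+2 *m B) =
    ((-1) ^+ l * l`!%:R) *: (C *m (- (l.+1%:R *: res x ^+ l.+2)) *m B).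
  rewrite mulmxN mulNmx -scalemxAr -scalemxAl -scaleNr scalerA; congr (_ *: _).
  by rewrite factS natrM exprS mulN1r mulrN mulNr (mulrC l.+1%:R) mulrA.
apply: cvgZ; first exact: cvg_cst.
apply: cvg_mulmx; last exact: cvg_cst.
by apply: cvg_mulmx; [exact: cvg_cst | exact: cvg_resolvent_exp_quotient].
Unshelve. all: by end_near. Qed.

End Resolvent.

(** * Moment matching by oblique projection *)

Section PetrovGalerkin.
Variables (K : fieldType) (n r : nat).

Lemma petrov_galerkin_moments (M : 'M[K]_n) (X : 'M[K]_(r, n))
    (Y : 'M[K]_(n, r)) (c : 'rV[K]_n) N :
  M \in unitmx -> X *m M *m Y \in unitmx -> X *m Y = 1%:M ->
  (forall l, (l < N)%N -> exists z, c *m invmx M ^+ l.+1 = z *m X) ->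
  forall l, (l < N)%N ->
    c *m invmx M ^+ l.+1 = c *m Y *m invmx (X *m M *m Y) ^+ l.+1 *m X.
Proof.
move=> Mu Mru XY span; set R := invmx (X *m M *m Y).
(* The premise of [step] is the previous moment identity multiplied by [Y], where [X *m Y = 1%:M]
   removes [X]; for [l = 0] it is trivial. *)
suff step l (lN : (l < N)%N) :
    c *m invmx M ^+ l *m Y = c *m Y *m R ^+ l ->
    c *m invmx M ^+ l.+1 = c *m Y *m R ^+ l.+1 *m X.
  elim=> [|l IHl] lN; first by apply: step; rewrite // !expr0 !mulmx1.
  by apply: (step _ lN); rewrite (IHl (ltnW lN)) -mulmxA XY mulmx1.
move=> stepl; have [z zE] := span l lN.
have zM : z *m (X *m M *m Y) = c *m Y *m R ^+ l.
  by rewrite !mulmxA -zE exprSr -mulmxE mulmxA mulmxKV.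
by rewrite zE exprSr -mulmxE (mulmxA _ (R ^+ l)) -zM mulmxK.
Qed.

End PetrovGalerkin.

(** * Conjugate transposes and congruences *)

Section ConjugateTranspose.
Variable T : realType.

Lemma mulmxH m n p (A : 'M[T[i]]_(m, n)) (B : 'M[T[i]]_(n, p)) :
  (A *m B)^H = B^H *m A^H.
Proof. by rewrite trmx_mul map_mxM. Qed.

Lemma mxHK m n (A : 'M[T[i]]_(m, n)) : (A^H)^H = A.
Proof. by apply/matrixP => i j; rewrite !mxE conjCK. Qed.

Lemma mxH_inv n (A : 'M[T[i]]_n) : (invmx A)^H = invmx (A^H).
Proof. by rewrite trmx_inv map_invmx. Qed.

Lemma unitmxH n (A : 'M[T[i]]_n) : (A^H \in unitmx) = (A \in unitmx).
Proof. by rewrite map_unitmx unitmx_tr. Qed.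

Lemma congruence_skew n r (J : 'M[T[i]]_n) (W : 'M[T[i]]_(n, r)) :
  J = - J^H -> W^H *m J *m W = - (W^H *m J *m W)^H.
Proof. by move=> {1}->; rewrite !mulmxH mxHK mulmxN mulNmx mulmxA. Qed.

Lemma congruence_form n r (R : 'M[T[i]]_n) (W : 'M[T[i]]_(n, r))
    (x : 'cV[T[i]]_r) :
  x^H *m (W^H *m R *m W) *m x = (W *m x)^H *m R *m (W *m x).
Proof. by rewrite mulmxH !mulmxA. Qed.

Lemma congruence_herm n r (R : 'M[T[i]]_n) (W : 'M[T[i]]_(n, r)) :
  R = R^H -> W^H *m R *m W = (W^H *m R *m W)^H.
Proof. by move=> {1}->; rewrite !mulmxH mxHK mulmxA. Qed.

Lemma congruence_psd n r (R : 'M[T[i]]_n) (W : 'M[T[i]]_(n, r)) :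
  herm_psd R -> herm_psd (W^H *m R *m W).
Proof.
move=> [RH R_ge0]; split=> [|x]; first exact: congruence_herm.
by rewrite congruence_form.
Qed.

(** The left inverse [X] makes [V] injective, so [V *m x] is nonzero whenever [x] is. *)
Lemma congruence_pd n r (Q : 'M[T[i]]_n) (V : 'M[T[i]]_(n, r))
    (X : 'M[T[i]]_(r, n)) :
  X *m V = 1%:M -> herm_pd Q -> herm_pd (V^H *m Q *m V).
Proof.
move=> XV [QH Q_gt0]; split=> [|x x0]; first exact: congruence_herm.
rewrite congruence_form; apply: Q_gt0; apply: contra_neq x0 => Vx0.
by rewrite -[x]mul1mx -XV -mulmxA Vx0 mulmx0.
Qed.

End ConjugateTranspose.

Theorem theorem4p3 (T : realType) (n m p r : nat)
    (J R Q : 'M[T[i]]_n) (B : 'M[T[i]]_(n, m)) (C : 'M[T[i]]_(p, n))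
    (s : T[i]) (c : 'cV[T[i]]_p) (N : nat) (W : 'M[T[i]]_(n, r)) :
  J = - J^H -> herm_psd R -> herm_pd Q ->
  (1 <= N)%N ->
  let M := s%:M - (J - R) *m Q in
  M \in unitmx ->
  orthonormal_cols W ->
  (forall l : nat, (1 <= l <= N)%N ->
    colspace W (c^H *m C *m invmx M *m (invmx M ^+ (l - 1)))^H) ->
  W^H *m (J - R)^H *m W \in unitmx ->
  let V := (J - R)^H *m W *m invmx (W^H *m (J - R)^H *m W) in
  let Jk := W^H *m J *m W in
  let Qk := V^H *m Q *m V in
  let Rk := W^H *m R *m W in
  let Bk := V^H *m B in
  let Ck := C *m V in
  let G := transfer_function ((J - R) *m Q) ((J - R) *m B) C in
  let Gk := transfer_function ((Jk - Rk) *m Qk) ((Jk - Rk) *m Bk) Ck in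
  dissipative_Hamiltonian Jk Rk Qk /\
  (s%:M - (Jk - Rk) *m Qk \in unitmx ->
   forall l : nat, (l <= N - 1)%N ->
     c^H *m derive1n l G s = c^H *m derive1n l Gk s).
Proof.
move=> JH Rpsd Qpd N_gt0 M Mu _ span Su V Jk Qk Rk Bk Ck G Gk.
pose F := J - R; pose S := W^H *m F^H *m W.
have WV : W^H *m V = 1%:M by rewrite /V !mulmxA mulmxV.
have FkE : Jk - Rk = W^H *m F *m W by rewrite /F mulmxBr mulmxBl.
have SH : S^H = Jk - Rk by rewrite FkE !mulmxH !mxHK mulmxA.
(* [V^H] is [invmx S^H *m W^H *m F], and [S^H] is [Jk - Rk], so the inverse cancels. *)
have FkV : (Jk - Rk) *m V^H = W^H *m F.
  rewrite /V !mulmxH mxH_inv -/F -/S SH mxHK mulKVmx// -SH unitmxH.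
  exact: Su.
split.
  split; [exact: congruence_skew | exact: congruence_psd |].
  exact: congruence_pd WV Qpd.
move=> Mku l lN.
have AkE : (Jk - Rk) *m Qk = W^H *m (F *m Q) *m V.
  by rewrite /Qk !mulmxA FkV.
have BkE : (Jk - Rk) *m Bk = W^H *m (F *m B) by rewrite !mulmxA FkV.
have MkE : s%:M - (Jk - Rk) *m Qk = W^H *m M *m V.
  (* The shift [s%:M] projects to [s%:M] because [W^H *m V = 1%:M]. *)
  rewrite AkE [W^H *m M]mulmxBr [RHS]mulmxBl mul_mx_scalar.
  by rewrite -[in RHS]scalemxAl WV scalemx1.
have moments : c^H *m C *m invmx M ^+ l.+1 =
    c^H *m Ck *m invmx (s%:M - (Jk - Rk) *m Qk) ^+ l.+1 *m W^H.
  rewrite MkE mulmxA; apply: (@petrov_galerkin_moments _ _ _ _ _ _ _ N) => //.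
  - by rewrite -MkE.
  (* [span] counts from 1, so index [k.+1] carries the extra power [k]; it concerns columns, and
     conjugate transposition turns the coefficient vector [z] into the row [z^H]. *)
  - move=> k kN; have [z _ zE] := span k.+1 kN; exists z^H.
    by rewrite -mulmxH zE mxHK subn1 exprS -mulmxE mulmxA.
  - by rewrite -[N](subnK N_gt0) addn1 ltnS.
have GE := derive1n_resolvent ((J - R) *m B) C l Mu.
have GkE := derive1n_resolvent ((Jk - Rk) *m Bk) Ck l Mku.
have -> : derive1n l G s = _ := GE.
have -> : derive1n l Gk s = _ := GkE.
rewrite -2!scalemxAr BkE; congr (_ *: _).
(* Both derivatives carry the same scalar; what remains is [moments] multiplied on the right by
   [F *m B]. *)
by rewrite 2![c^H *m _]mulmxA 2![c^H *m (_ *m _)]mulmxA moments -mulmxA.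
Qed.
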